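(* Let $f:\mathbb{N}\to\mathbb{N}$ be the Collatz map, let $\mathcal{H}$ be a complex Hilbert space with orthonormal basis $\{e_n\}_{n\in\mathbb{N}}$, and let $T\in\mathcal{B}(\mathcal{H})$ be the bounded linear operator determined by $Te_n=e_{f(n)}$ for all $n\in\mathbb{N}$. If $C^{*}(T)$ has no non-trivial reducing subspaces, then the Collatz conjecture holds.
   Context: $\mathbb{N}$ is the set of positive integers. The Collatz map is $f(n)=3n+1$ for $n$ odd and $f(n)=n/2$ for $n$ even. The Collatz conjecture is the statement: for every $n\in\mathbb{N}$ there is an integer $m\ge 0$ with $f^m(n)=1$, where $f^m$ is the $m$-th iterate ($f^0=\mathrm{id}$). $\mathcal{B}(\mathcal{H})$ is the algebra of bounded linear operators on $\mathcal{H}$. The operator $T$ is well defined and bounded because each $f^{-1}(n)$ has at most two elements; explicitly $T(\sum_n x_n e_n)=\sum_{n}\big(\sum_{m\in f^{-1}(n)}x_m\big)e_n$. A $C^*$-algebra in $\mathcal{B}(\mathcal{H})$ is a norm-closed linear subspace of $\mathcal{B}(\mathcal{H})$ closed under products and adjoints; $C^*(T)$ is the $C^*$-algebra generated by $T$, i.e. the smallest $C^*$-algebra in $\mathcal{B}(\mathcal{H})$ containing $T$. A reducing subspace of a $C^*$-algebra $\mathcal{A}\subseteq\mathcal{B}(\mathcal{H})$ is a closed subspace $\mathcal{M}\subseteq\mathcal{H}$ with $S\mathcal{M}\subseteq\mathcal{M}$ and $S^*\mathcal{M}\subseteq\mathcal{M}$ for all $S\in\mathcal{A}$; the trivial ones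 are $\{0\}$ and $\mathcal{H}$. *)

(* Defs.v *)
From HB Require Import structures.
From mathcomp Require Import all_boot all_order all_algebra.
From mathcomp Require Import complex.
From mathcomp Require Import boolp classical_sets functions reals.
From mathcomp Require Import topology normedtype.

Set Implicit Arguments.
Unset Strict Implicit.
Unset Printing Implicit Defensive.

Import Order.TTheory GRing.Theory Num.Theory.

Local Open Scope classical_set_scope.
Local Open Scope ring_scope.
Local Open Scope complex_scope.

Definition posnat := {n : nat | (0 < n)%N}.

Definition collatz_nat (n : nat) : nat :=
  if odd n then (3 * n + 1)%N else n./2.

Lemma collatz_nat_gt0 (n : nat) : (0 < n)%N -> (0 < collatz_nat n)%N.
Proof. by case: n => [//|[//|n] _]; rewrite /collatz_nat addn1; case: ifP. Qed.

Definition collatz (n : posnat) : posnat :=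
  exist _ (collatz_nat (val n)) (collatz_nat_gt0 (valP n)).

Definition collatz_conjecture : Prop :=
  forall n : posnat, exists m : nat, val (iter m collatz n) = 1%N.

Definition linear_subspace (K : nzRingType) (V : lmodType K) (M : set V) : Prop :=
  M 0 /\ forall (a : K) (x y : V), M x -> M y -> M (a *: x + y).

Definition linear_span (K : nzRingType) (V : lmodType K) (I : Type) (e : I -> V)
    : set V :=
  [set x | exists (s : seq I) (c : I -> K), x = \sum_(i <- s) c i *: e i].

(* The inner product [dot] is linear in its first argument and conjugate-linear
   in the second; [is_hilbert dot] says that it induces the norm of [H], which
   is complete by its type. *)
Definition is_hilbert (R : realType) (H : completeNormedModType R[i])
    (dot : {dot H for Num.conj}) : Prop :=
  forall x : H, `|x| ^+ 2 = dot x x.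

Definition orthonormal_basis (R : realType) (H : completeNormedModType R[i])
    (dot : {dot H for Num.conj}) (I : eqType) (e : I -> H) : Prop :=
  (forall i j : I, dot (e i) (e j) = (i == j)%:R) /\
  closure (linear_span e) = [set: H].

Section Operators.
Variables (R : realType) (H : completeNormedModType R[i]).
Variable dot : {dot H for Num.conj}.
Implicit Types (S : H -> H) (A : set (H -> H)) (M : set H).

Definition bounded_operator S : Prop :=
  linear S /\ exists c : R, forall x : H, `|S x| <= c%:C * `|x|.

Definition opnorm S : R :=
  inf [set c : R | 0 <= c /\ forall x : H, `|S x| <= c%:C * `|x|].

(* [S'] is the adjoint of [S]. It is unique, and for bounded [S] it exists by
   the Riesz representation theorem; a condition on "the adjoint of [S]" is
   expressed below by quantifying over [S'] with [is_adjoint S S']. *)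
Definition is_adjoint S S' : Prop :=
  bounded_operator S' /\ forall x y : H, dot (S x) y = dot x (S' y).

Definition opnorm_closed A : Prop :=
  forall S, bounded_operator S ->
    (forall eps : R, 0 < eps -> exists2 S', A S' & opnorm (S' - S) < eps) ->
    A S.

(* Not required to contain the identity. *)
Definition is_cstar_algebra A : Prop :=
  [/\ A `<=` [set S | bounded_operator S],
      linear_subspace A,
      opnorm_closed A,
      forall S1 S2, A S1 -> A S2 -> A (S1 \o S2) &
      forall S S', A S -> is_adjoint S S' -> A S'].

Definition cstar_generated (T : H -> H) : set (H -> H) :=
  smallest is_cstar_algebra [set T].

Definition reducing_subspace A M : Prop :=
  [/\ linear_subspace M,
      closed M,
      forall S, A S -> S @` M `<=` M &
      forall S S', A S -> is_adjoint S S' -> S' @` M `<=` M].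

Definition no_nontrivial_reducing_subspace A : Prop :=
  forall M, reducing_subspace A M -> M = [set 0] \/ M = [set: H].

End Operators.

(* Main.v *)
(** The closed span of the [e n] with [n] in the orbit tree of 1 reduces [T],
    because both this set of indices and its complement are mapped into
    themselves by the Collatz map. The bounded operators leaving invariant two
    complementary coordinate subspaces form a C*-algebra, so the same span
    reduces [C*(T)]. It contains [e 1], hence is everything, hence no [e n] is
    orthogonal to it. *)
Require Import Defs.
From mathcomp Require Import all_boot all_order all_algebra.
From mathcomp Require Import complex.
From mathcomp Require Import boolp classical_sets functions reals.
From mathcomp Require Import topology normedtype.

Local Open Scope ring_scope.
Local Open Scope complex_scope.

Import Order.TTheory GRing.Theory Num.Theory.

(** * Linear subspaces: finite sums and preimages *)

Section LinearSubspace.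
Set Implicit Arguments.
Unset Strict Implicit.
Variables (K : nzRingType) (V : lmodType K).
Implicit Type M : set V.

Lemma linear_subspace_sum M (I : Type) (s : seq I) (P : pred I) (c : I -> K)
    (v : I -> V) :
  linear_subspace M -> (forall i, P i -> M (v i)) ->
  M (\sum_(i <- s | P i) c i *: v i).
Proof.
move=> [M0 MD] Mv; elim: s => [|i s IHs]; first by rewrite big_nil.
by rewrite big_cons; case: ifP => // Pi; apply: MD => //; apply: Mv.
Qed.

Lemma linear_subspace_preimage M (S : V -> V) :
  linear S -> linear_subspace M -> linear_subspace (S @^-1` M)%classic.
Proof.
move=> Slin [M0 MD]; split=> [|a x y Mx My]; rewrite /preimage /=.
  have := Slin (-1) 0 0; rewrite scaler0 addr0 scaleN1r addNr.
  by move=> ->.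
by rewrite Slin; apply: MD.
Qed.

End LinearSubspace.

(** * Bounded operators, operator norm and closures *)

Section BoundedOperators.
Set Implicit Arguments.
Unset Strict Implicit.
Variables (R : realType) (H : completeNormedModType R[i]).
Implicit Types S : H -> H.

Lemma bounded_operator_linear_subspace :
  linear_subspace (@bounded_operator R H).
Proof.
split.
  split=> [a x y|]; first by rewrite /= scaler0 addr0.
  by exists 0 => x; rewrite /= normr0 mul0r.
move=> a S1 S2 [S1lin [c1 S1b]] [S2lin [c2 S2b]]; split.
  move=> b x y; rewrite !fctE S1lin S2lin.
  by rewrite !scalerDr !scalerA (mulrC a b) addrACA.
(* The bound must lie in [R], so the modulus of [a] is taken as a real number. *)
exists (Normc.normc a * c1 + c2) => x; rewrite !fctE.
rewrite rmorphD rmorphM /= mulrDl -mulrA.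
apply: le_trans (ler_normD _ _) _; rewrite normrZ lerD //.
by rewrite ler_wpM2l.
Qed.

Lemma bounded_operator_comp S1 S2 :
  bounded_operator S1 -> bounded_operator S2 -> bounded_operator (S1 \o S2).
Proof.
move=> [S1lin [c1 S1b]] [S2lin [c2 S2b]]; split.
  by move=> a x y; rewrite /= S2lin S1lin.
exists (`|c1| * c2) => x /=; rewrite rmorphM /= -mulrA.
apply: le_trans (S1b _) _.
apply: (@le_trans _ _ (`|c1|%:C * `|S2 x|)); last first.
  by rewrite ler_wpM2l // lecR.
by rewrite ler_wpM2r // lecR ler_norm.
Qed.

Lemma opnorm_lt_bound S (eps : R) :
  bounded_operator S -> opnorm S < eps ->
  forall x, `|S x| <= eps%:C * `|x|.
Proof.
move=> [_ [c Sc]] /inf_lt[].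
  (* The set of bounds is nonempty; [c] itself might be negative. *)
  exists `|c|; split=> // x; apply: le_trans (Sc x) _.
  by rewrite ler_wpM2r // lecR ler_norm.
move=> d [_ Sd] /ltW dle x; apply: le_trans (Sd x) _.
by rewrite ler_wpM2r // lecR.
Qed.

(** Norms take values in [R[i]], hence the complex [eps]; [0 < eps] forces it to be real. *)
Lemma closure_approx (M : set H) x :
  closure M x <-> forall eps : R[i], 0 < eps -> exists2 y, M y & `|x - y| < eps.
Proof.
split=> [clx eps eps0 | app B].
  have [y [My xy]] := clx _ (nbhsx_ballx x _ eps0).
  by exists y => //; move: xy; rewrite -ball_normE.
move=> /nbhs_ballP[eps /= eps0 epsB]; have [y My xy] := app _ eps0.
by exists y; split=> //; apply: epsB; rewrite -ball_normE.
Qed.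

Lemma bounded_operator_preimage_closed S (M : set H) :
  bounded_operator S -> closed M -> closed (S @^-1` M)%classic.
Proof.
move=> [Slin [c Sc]] Mcl x /closure_approx app; apply: Mcl.
apply/closure_approx => eps eps0.
(* A Lipschitz constant by which one can divide, whatever [c] is. *)
have c1 : 0 < (`|c| + 1)%:C :> R[i] by rewrite ltcR ltr_wpDl.
have [y My xy] := app _ (divr_gt0 eps0 c1); exists (S y) => //.
have -> : S x - S y = S (x - y).
  by rewrite addrC -scaleN1r -Slin scaleN1r addrC.
apply: le_lt_trans (Sc _) _.
apply: (@le_lt_trans _ _ ((`|c| + 1)%:C * `|x - y|)).
  by rewrite ler_wpM2r // lecR (le_trans (ler_norm c)) // lerDl.
by rewrite mulrC -ltr_pdivlMr.
Qed.

End BoundedOperators.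

(** * Inner products and coordinate subspaces *)

Section CoordinateSubspace.
Set Implicit Arguments.
Unset Strict Implicit.
Variables (R : realType) (H : completeNormedModType R[i]).
Variable dot : {dot H for Num.conj}.
Hypothesis hH : is_hilbert dot.
Variables (I : eqType) (e : I -> H).
Hypothesis he : orthonormal_basis dot e.
Implicit Types (P : set I) (S : H -> H) (x y : H).

Lemma dot_eq0C x y : dot x y = 0 -> dot y x = 0.
Proof. by move=> /eqP xy; apply/eqP; rewrite herm_eq0C. Qed.

Lemma pythagoras x y : dot x y = 0 -> `|x + y| ^+ 2 = `|x| ^+ 2 + `|y| ^+ 2.
Proof. by move=> xy; rewrite (hH (x + y)) (hH x) (hH y); apply: hnormDd. Qed.

(** Split [x] into its projection [a *: y] and an orthogonal remainder, then apply Pythagoras. *)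
Lemma norm_dot_unit x y : dot y y = 1 -> `|dot x y| <= `|x|.
Proof.
move=> yy; set a := dot x y.
have y1 : `|y| = 1 by apply/eqP; rewrite -sqrp_eq1 // hH yy.
have xy : dot (x - a *: y) (a *: y) = 0.
  by rewrite linearZr_LR /= linearBl /= linearZl_LR /= yy mulr1 subrr mulr0.
have := pythagoras xy; rewrite subrK normrZ y1 mulr1 => xE.
by rewrite -(@ler_pXn2r _ 2) ?nnegrE // xE lerDr exprn_ge0.
Qed.

Lemma cauchy_schwarz x y : `|dot x y| <= `|x| * `|y|.
Proof.
have [->|y0] := eqVneq y 0; first by rewrite linear0r !normr0 mulr0.
have ny0 : `|y| != 0 by rewrite normr_eq0.
pose u := `|y|^-1 *: y.
have yE : y = `|y| *: u by rewrite scalerA divff // scale1r.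
have uu : dot u u = 1.
  by rewrite -hH normrZ normfV normr_id mulVf // expr1n.
rewrite {1}yE linearZr_LR /= normrM norm_conjC normr_id mulrC.
by rewrite ler_wpM2r // norm_dot_unit.
Qed.

Lemma dot_kernel_closed y : closed [set x | dot x y = 0]%classic.
Proof.
move=> x /closure_approx app; have [->|y0] := eqVneq y 0; first exact: linear0r.
apply/eqP; rewrite -normr_le0; apply/ler_addgt0Pr => eps eps0.
have ny0 : 0 < `|y| by rewrite normr_gt0.
have [z /= zy xz] := app _ (divr_gt0 eps0 ny0).
(* Since [dot z y = 0], replacing [x] by [x - z] does not change the product with [y]. *)
rewrite add0r; have := cauchy_schwarz (x - z) y.
rewrite linearBl /= zy subr0 => /le_trans; apply.
by rewrite -ler_pdivlMr // ltW.
Qed.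

(** This is the closed span of the [e i] with [P i], encoded by vanishing coordinates so that
    closedness is immediate; [coord_subspace_min] recovers the span. *)
Definition coord_subspace P : set H :=
  [set x | forall i, ~ P i -> dot x (e i) = 0]%classic.

Lemma coord_subspace_linear P : linear_subspace (coord_subspace P).
Proof.
split=> [i _|a x y Px Py i nPi]; first by rewrite linear0l.
by rewrite linearPl /= Px // Py // mulr0 addr0.
Qed.

Lemma coord_subspace_closed P : closed (coord_subspace P).
Proof.
have -> : coord_subspace P =
    (\bigcap_(i in ~` P) [set x | dot x (e i) = 0])%classic.
  by [].
by apply: closed_bigI => i _; apply: dot_kernel_closed.
Qed.

Lemma coord_subspace_basis P i : P i -> coord_subspace P (e i).
Proof.
move=> Pi j nPj; rewrite (proj1 he); case: eqP => // ij.
by rewrite -ij in nPj.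
Qed.

(* Dropping from an approximation of [x] the terms outside [P] only improves
   it, by Pythagoras. *)
Lemma coord_subspace_min P (M : set H) :
  linear_subspace M -> closed M -> (forall i, P i -> M (e i)) ->
  (coord_subspace P `<=` M)%classic.
Proof.
move=> Mlin Mcl Me x Px; apply: Mcl; apply/closure_approx => eps eps0.
have /closure_approx/(_ _ eps0)[_ [s [c ->]] xy] : closure (linear_span e) x.
  by rewrite (proj2 he).
pose p : pred I := fun i => `[< P i >].
have pP i : p i -> P i by move/asboolP.
pose u := \sum_(i <- s | p i) c i *: e i.
exists u; first by apply: linear_subspace_sum => // i /pP/Me.
pose v := \sum_(i <- s | ~~ p i) c i *: e i.
have uP : coord_subspace P u.
  apply: linear_subspace_sum => [|i /pP]; first exact: coord_subspace_linear.
  exact: coord_subspace_basis.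
have xuv : dot (x - u) (- v) = 0.
  rewrite linearNr linear_sumr /= big1 ?oppr0 // => i /asboolP nPi.
  by rewrite linearZr_LR /= linearBl /= Px // uP // subrr mulr0.
apply: le_lt_trans xy; rewrite (bigID p) /= -/u -/v opprD addrA.
by rewrite -(@ler_pXn2r _ 2) ?nnegrE // (pythagoras xuv) lerDl exprn_ge0.
Qed.

(** For fixed [y], the vectors orthogonal to [y] form a closed subspace containing every [e i] with
    [P i], so minimality applies. *)
Lemma coord_subspace_orth P x y :
  coord_subspace P x -> coord_subspace (~` P)%classic y -> dot x y = 0.
Proof.
move=> Px Py.
suff /(_ _ Px) : (coord_subspace P `<=` [set z | dot z y = 0])%classic by [].
apply: coord_subspace_min.
- split=> [|a u v /= u0 v0]; first by rewrite /= linear0l.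
  by rewrite linearPl /= u0 v0 mulr0 addr0.
- exact: dot_kernel_closed.
- by move=> i Pi; apply: dot_eq0C; apply: Py => /(_ Pi).
Qed.

Lemma coord_subspace_orthP P x :
  (forall y, coord_subspace (~` P)%classic y -> dot y x = 0) ->
  coord_subspace P x.
Proof.
move=> orth i nPi; apply: dot_eq0C; apply: orth.
exact: coord_subspace_basis.
Qed.

(** * Operators leaving coordinate subspaces invariant *)

Definition stabilizer P : set (H -> H) :=
  [set S : H -> H | bounded_operator S /\
    forall x, coord_subspace P x -> coord_subspace P (S x)]%classic.

Lemma stabilizer_linear P : linear_subspace (stabilizer P).
Proof.
have [b0 bD] := bounded_operator_linear_subspace H.
have [P0 PD] := coord_subspace_linear P.
split=> [|a S1 S2 [b1 S1P] [b2 S2P]]; split=> //; first exact: bD.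
by move=> x Px; apply: PD; [apply: S1P | apply: S2P].
Qed.

Lemma stabilizer_comp P S1 S2 :
  stabilizer P S1 -> stabilizer P S2 -> stabilizer P (S1 \o S2).
Proof.
move=> [b1 S1P] [b2 S2P]; split; first exact: bounded_operator_comp.
by move=> x Px; apply/S1P/S2P.
Qed.

Lemma stabilizer_opnorm_closed P : opnorm_closed (stabilizer P).
Proof.
move=> S bS app; split=> // x Px; apply: coord_subspace_closed.
apply/closure_approx => eps eps0.
(* Adding 1 keeps the divisor positive when [x] is 0. *)
have x1 : 0 < `|x| + 1 by rewrite ltr_wpDl.
have d0 := divr_gt0 eps0 x1.
(* [opnorm] is compared with elements of [R]; the quotient is real, so its real part loses
   nothing. *)
have dE : (complex.Re (eps / (`|x| + 1)))%:C = eps / (`|x| + 1).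
  by rewrite RRe_real // gtr0_real.
have : 0 < complex.Re (eps / (`|x| + 1)) by rewrite -ltcR dE.
move=> /app[S' [bS' S'P] /opnorm_lt_bound Sb].
exists (S' x); first exact: S'P.
have bB : bounded_operator (S' - S).
  have [_ bD] := bounded_operator_linear_subspace H.
  by rewrite addrC -scaleN1r; apply: bD.
rewrite distrC; apply: le_lt_trans (Sb bB x) _.
by rewrite dE -mulrA gtr_pMr // ltr_pdivrMl // mulr1 ltrDl.
Qed.

(** For [y] in the complementary subspace, [dot y (S' x) = dot (S y) x = 0], because [S y] stays
    there. *)
Lemma stabilizer_adjoint P S S' :
  stabilizer (~` P)%classic S -> is_adjoint dot S S' -> stabilizer P S'.
Proof.
move=> [_ SP] [bS' adj]; split=> // x Px; apply: coord_subspace_orthP => y Py.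
by rewrite -adj; apply: dot_eq0C; apply: coord_subspace_orth Px _; apply: SP.
Qed.

(** Passing to adjoints exchanges the stabilizers of [P] and of its complement, so their
    intersection is closed under adjoints. *)
Lemma stabilizers_cstar_algebra P :
  is_cstar_algebra dot (stabilizer P `&` stabilizer (~` P))%classic.
Proof.
have [P0 PD] := stabilizer_linear P.
have [Q0 QD] := stabilizer_linear (~` P)%classic.
split=> [S [[]]//||S bS app|S1 S2 [P1 Q1] [P2 Q2]|S S' [PS QS] adj].
- by split=> // a S1 S2 [P1 Q1] [P2 Q2]; split; [apply: PD | apply: QD].
- by split; apply: stabilizer_opnorm_closed => // eps /app[S' []]; exists S'.
- by split; apply: stabilizer_comp.
- split; first exact: stabilizer_adjoint adj.
  by apply: stabilizer_adjoint adj; rewrite setCK.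
Qed.

(** The preimage under [T] of the coordinate subspace is a closed subspace containing each [e i]
    with [P i]; minimality does the rest. *)
Lemma stabilizer_index_map P (T : H -> H) (g : I -> I) :
  bounded_operator T -> (forall i, T (e i) = e (g i)) ->
  (forall i, P i -> P (g i)) -> stabilizer P T.
Proof.
move=> bT Te Pg; split=> //; apply: coord_subspace_min.
- apply: linear_subspace_preimage; first by case: bT.
  exact: coord_subspace_linear.
- exact: bounded_operator_preimage_closed (@coord_subspace_closed P).
- by move=> i /Pg Pi; rewrite /preimage /= Te; apply: coord_subspace_basis.
Qed.

Lemma reducing_coord_subspace P (T : H -> H) (g : I -> I) :
  bounded_operator T -> (forall i, T (e i) = e (g i)) ->
  (forall i, P (g i) <-> P i) ->
  reducing_subspace dot (cstar_generated dot T) (coord_subspace P).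
Proof.
move=> bT Te Pg.
have genP :
    (cstar_generated dot T `<=` stabilizer P `&` stabilizer (~` P))%classic.
  apply: smallest_sub; first exact: stabilizers_cstar_algebra.
  move=> _ ->; split; apply: (stabilizer_index_map bT Te) => i; rewrite ?Pg //.
  by move=> nPi /Pg.
split; [exact: coord_subspace_linear|exact: coord_subspace_closed|..].
  by move=> S /genP[[_ SP] _] _ [x Px <-]; apply: SP.
(* Invariance under [S'] comes from the invariance of the complementary subspace under [S]. *)
move=> S S' /genP[_ QS] /(stabilizer_adjoint QS)[_ SP] _ [x Px <-].
exact: SP.
Qed.

End CoordinateSubspace.

(** * The orbit tree of 1 and the conclusion *)

Lemma collatz_orbit1 n :
  (exists m, val (iter m collatz (collatz n)) = 1%N) <->
  (exists m, val (iter m collatz n) = 1%N).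
Proof.
split=> [[m nm]|[[|m] nm]]; first by exists m.+1; rewrite iterSr.
  (* Here [n] is 1 already, and its image 4 returns to 1 in two steps through 2. *)
  by exists 2%N; rewrite /= /collatz_nat nm.
by exists m; rewrite -iterSr.
Qed.

Theorem corollary4p1p3 (R : realType) (H : completeNormedModType R[i])
    (dot : {dot H for Num.conj}) (e : posnat -> H) (T : H -> H)
    (hH : is_hilbert dot)
    (he : orthonormal_basis dot e)
    (hT : bounded_operator T)
    (hTe : forall n : posnat, T (e n) = e (collatz n)) :
  no_nontrivial_reducing_subspace dot (cstar_generated dot T) ->
  collatz_conjecture.
Proof.
pose P : set posnat := [set n | exists m, val (iter m collatz n) = 1%N]%classic.
move=> irr.
have /irr[P0|PT] : reducing_subspace dot (cstar_generated dot T)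
    (coord_subspace dot e P).
  by apply: reducing_coord_subspace hT hTe _ => // n; apply: collatz_orbit1.
  (* The zero subspace is excluded: it would contain the unit vector [e one]. *)
  pose one : posnat := exist _ 1%N isT.
  have : coord_subspace dot e P (e one).
    by apply: coord_subspace_basis => //; exists 0%N.
  rewrite P0 /= => e0; have := proj1 he one one.
  by rewrite e0 linear0l eqxx => /esym/eqP; rewrite oner_eq0.
(* If [n] never reached 1, then [e n], lying in the whole space, would be orthogonal to itself. *)
move=> n; apply: contrapT => nP.
have : coord_subspace dot e P (e n) by rewrite PT.
by move=> /(_ n nP)/eqP; rewrite (proj1 he) eqxx oner_eq0.
Qed.
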